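(* Let $G$ be a weakly branch group (acting on a spherically homogeneous rooted tree). Then the following hold: (i) $\overline{\mathrm{L}}(G)=1$. (ii) If the set of finite order elements of $\mathrm{L}(G)$ is non-trivial (i.e. contains an element other than the identity), then it is a $p$-set for some prime $p$, and the rigid stabilizer $\mathrm{rst}_G(n)$ is a $p$-group for some $n\ge 1$.
   Context: Engel elements. For $g,x$ in a group $G$ put $[g,_0 x]=g$ and $[g,_n x]=[[g,_{n-1}x],x]$ for $n\ge 1$. An element $x\in G$ is a left Engel element of $G$ if for every $g\in G$ there is $n=n(g,x)\in\mathbb{N}$ with $[g,_n x]=1$; it is a bounded left Engel element if there is $n\in\mathbb{N}$ with $[g,_n x]=1$ for all $g\in G$. The sets of left Engel and bounded left Engel elements are denoted $\mathrm{L}(G)$ and $\overline{\mathrm{L}}(G)$. Trees. Let $(d_n)_{n\ge 1}$ be a sequence of integers greater than $1$. The corresponding spherically homogeneous rooted tree $\mathcal{T}$ is the rooted tree in which every vertex at level $n$ (distance $n$ from the root) has exactly $d_{n+1}$ immediate descendants. $\mathcal{L}_n$ is the set of vertices at level $n$, $\mathcal{T}_v$ is the subtree hanging from the vertex $v$, and $\mathrm{Aut}\,\mathcal{T}$ is the group of automorphisms of $\mathcal{T}$ (bijections of the vertex set preserving the root and incidence). For $G\le \mathrm{Aut}\,\mathcal{T}$ and a vertex $v$, the rigid stabilizer of $v$ is $\mathrm{rst}_G(v)=\{g\in G\mid g(u)=u \text{ for all vertices } u \text{ outside } \mathcal{T}_v\}$, and $\mathrm{rst}_G(n)=\langle \mathrm{rst}_G(v)\mid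 v\in\mathcal{L}_n\rangle=\prod_{v\in\mathcal{L}_n}\mathrm{rst}_G(v)$. The group $G$ is spherically transitive if it acts transitively on every $\mathcal{L}_n$. A weakly branch group is a spherically transitive subgroup $G\le\mathrm{Aut}\,\mathcal{T}$ with $\mathrm{rst}_G(n)\ne 1$ for all $n\in\mathbb{N}$. An element is a $p$-element if its order is a power of the prime $p$; a subset of a group is a $p$-set if all its elements are $p$-elements; a (possibly infinite) group is a $p$-group if all its elements are $p$-elements. *)

(* Defs.v *)
From HB Require Import structures.
From mathcomp Require Import all_boot.
From mathcomp Require Import boolp classical_sets.

Set Implicit Arguments.
Unset Strict Implicit.
Unset Printing Implicit Defensive.

Local Open Scope classical_set_scope.
Local Open Scope group_scope.

Section Groups.
Variable gT : groupType.
Implicit Types (G A : set gT) (x g : gT) (p n : nat).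

Definition engel_comm n g x : gT := iter n (fun h => [~ h, x]) g.

Definition left_engel G : set gT :=
  [set x | G x /\ forall g, G g -> exists n, engel_comm n g x = 1].

Definition bounded_left_engel G : set gT :=
  [set x | G x /\ exists n, forall g, G g -> engel_comm n g x = 1].

Definition has_order x n : Prop :=
  [/\ (0 < n)%N, x ^+ n = 1 & forall m, (0 < m < n)%N -> x ^+ m <> 1].

Definition finite_order : set gT := [set x | exists n, has_order x n].

Definition p_element p : set gT := [set x | exists k, has_order x (p ^ k)%N].

Definition p_set p A : Prop := A `<=` p_element p.

Definition subgroup G : Prop := group_closed (mem G).

Definition generated A : set gT := smallest subgroup A.

End Groups.

Section Tree.
Variable d : nat -> nat.

(* The tree is encoded by words: a vertex at level [n] is a word
   [w_0 ... w_(n-1)] with [w_i < d i], and its immediate descendants are its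
   one-letter extensions. So [d n] is the number of immediate descendants of a
   vertex at level [n], i.e. the sequence is indexed from 0. *)
Definition is_vertex (w : seq nat) : bool :=
  all (fun i => nth 0 w i < d i)%N (iota 0 (size w)).

Record vertex := Vertex { word :> seq nat; wordP : is_vertex word }.

HB.instance Definition _ := [isSub for word].
HB.instance Definition _ := [Countable of vertex by <:].

Definition tree_root : vertex := @Vertex [::] isT.

Definition level n : set vertex := [set v | size v = n].

(* The vertex set of the subtree hanging from [v]. *)
Definition subtree (v : vertex) : set vertex := [set u | prefix v u].

Definition child (u v : vertex) : bool :=
  prefix u v && (size v == (size u).+1).

Definition incident (u v : vertex) : bool := child u v || child v u.

Record aut := Aut {
  aut_fun :> vertex -> vertex;
  aut_bij : bijective aut_fun;
  aut_root : aut_fun tree_root = tree_root;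
  aut_incident : forall u v, incident (aut_fun u) (aut_fun v) = incident u v
}.

Lemma autP (f g : aut) : f =1 g -> f = g.
Proof.
case: f g => [f bf rf jf] [g bg rg jg] /= /funext efg; subst g.
by rewrite (Prop_irrelevance bf bg) (Prop_irrelevance rf rg)
           (Prop_irrelevance jf jg).
Qed.

HB.instance Definition _ := gen_eqMixin aut.
HB.instance Definition _ := gen_choiceMixin aut.

Definition aut1 : aut :=
  @Aut id (Bijective (fun=> erefl) (fun=> erefl)) erefl (fun _ _ => erefl).

Lemma aut_mul_root (f g : aut) : (f \o g) tree_root = tree_root.
Proof. by rewrite /= !aut_root. Qed.

Lemma aut_mul_incident (f g : aut) u v :
  incident ((f \o g) u) ((f \o g) v) = incident u v.
Proof. by rewrite /= !aut_incident. Qed.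

Definition aut_mul (f g : aut) : aut :=
  @Aut (f \o g) (bij_comp (aut_bij f) (aut_bij g))
    (aut_mul_root f g) (aut_mul_incident f g).

Lemma aut_inv_subproof (f : aut) :
  exists f' : aut, cancel f f' /\ cancel f' f.
Proof.
have [g fK gK] := aut_bij f.
have rg : g tree_root = tree_root by rewrite -{1}(aut_root f) fK.
have jg u v : incident (g u) (g v) = incident u v.
  by rewrite -(aut_incident f) !gK.
by exists (@Aut g (Bijective gK fK) rg jg).
Qed.

Definition aut_inv (f : aut) : aut := projT1 (cid (aut_inv_subproof f)).

Lemma aut_invK (f : aut) : cancel f (aut_inv f).
Proof. by rewrite /aut_inv; case: cid => g /= []. Qed.

Lemma autK_inv (f : aut) : cancel (aut_inv f) f.
Proof. by rewrite /aut_inv; case: cid => g /= []. Qed.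

Lemma aut_mulA : associative aut_mul.
Proof. by move=> f g h; exact: autP. Qed.

Lemma aut_mul1 : left_id aut1 aut_mul.
Proof. by move=> f; exact: autP. Qed.

Lemma aut_mulr1 : right_id aut1 aut_mul.
Proof. by move=> f; exact: autP. Qed.

Lemma aut_mulV : left_inverse aut1 aut_inv aut_mul.
Proof. by move=> f; apply: autP; exact: aut_invK. Qed.

Lemma aut_mulVr : right_inverse aut1 aut_inv aut_mul.
Proof. by move=> f; apply: autP; exact: autK_inv. Qed.

(* Automorphisms act on the left: [(f * g) v = f (g v)]. *)
HB.instance Definition _ := isGroup.Build aut
  aut_mulA aut_mul1 aut_mulr1 aut_mulV aut_mulVr.

Lemma aut1E v : (1 : aut) v = v. Proof. by []. Qed.

Lemma autME (f g : aut) v : (f * g) v = f (g v). Proof. by []. Qed.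

Lemma autVK (f : aut) : cancel f f^-1. Proof. exact: aut_invK. Qed.

Lemma autKV (f : aut) : cancel f^-1 f. Proof. exact: autK_inv. Qed.

Implicit Type G : set aut.

Definition rst G (v : vertex) : set aut :=
  [set g | G g /\ forall u, ~ subtree v u -> g u = u].

Definition rst_level G n : set aut :=
  generated (\bigcup_(v in level n) rst G v).

Definition spherically_transitive G : Prop :=
  forall n u v, level n u -> level n v -> exists2 g, G g & g u = v.

Definition weakly_branch G : Prop :=
  [/\ subgroup G, spherically_transitive G
    & forall n, rst_level G n <> [set 1]].

End Tree.

(* Main.v *)
Require Import Defs.
From mathcomp Require Import all_boot all_algebra zify.
From mathcomp Require Import boolp classical_sets.

Set Implicit Arguments.
Unset Strict Implicit.
Unset Printing Implicit Defensive.

Local Open Scope classical_set_scope.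
Local Open Scope group_scope.

(* Let [v] have an orbit of length [r > 1] under [x], such that [x ^ r] is trivial
   on the subtree of [v]; such [v] exist below every vertex moved by [x] when [x]
   has finite order. For [g] in the rigid stabilizer of [v], the conjugates of [g]
   by powers of [x] commute and are permuted cyclically, so that [[g,_n x] = 1]
   says that [g ^ c = 1] for every coefficient [c] of [(X - 1) ^ n] modulo
   [X ^ r - 1]. These do not all vanish modulo a prime [q] unless [r] is a power
   of [q]. So [r] is a power of a prime [p] and [g] is a [p]-element, which
   gives (ii) by conjugation. If [n] is uniform in [g], then the rigid stabilizer
   has finite exponent, which is impossible in a weakly branch group; and if [x]
   has infinite order, an orbit of length [> n] already shows [[g,_n x] <> 1]. *)

(** * Finite differences and their divisibility by primes *)

Section FiniteDifferences.
Import GRing.Theory.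
Local Open Scope ring_scope.

Definition diff (V : zmodType) (f : nat -> V) : nat -> V :=
  fun i => f i.+1 - f i.

Lemma iter_diffS (V : zmodType) (f : nat -> V) n i :
  iter n.+1 (@diff V) f i = iter n (@diff V) f i.+1 - iter n (@diff V) f i.
Proof. by []. Qed.

Lemma iter_diff_eq0 (V : zmodType) (f : nat -> V) n m :
  (n <= m)%N -> (forall i, iter n (@diff V) f i = 0) ->
  forall i, iter m (@diff V) f i = 0.
Proof.
move=> /subnK <- fn0; elim: (m - n)%N => // k IHk i.
by rewrite addSn iter_diffS !IHk subr0.
Qed.

(** For an orbit longer than [n]: [diff] shortens the stretch of zeros after index 0 by one and
    negates the value at 0. *)
Lemma iter_diff_concentrated (f : nat -> int) n :
  (forall i, (0 < i <= n)%N -> f i = 0) ->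
  iter n (@diff int) f 0%N = (-1) ^+ n * f 0%N.
Proof.
elim: n f => [|n IHn] f f0; first by rewrite mul1r.
rewrite iterSr IHn /diff; last first.
  by move=> i /andP[i0 lein]; rewrite !f0 ?subr0 ?i0 //= ltnW.
by rewrite f0 // sub0r exprSr mulrN1 mulrN mulNr.
Qed.

(* The iterate [iter n diff (multiples r)] lists the coefficients of
   [(X - 1) ^ n] modulo [X ^ r - 1], in reverse order and repeated with period
   [r]. *)
Definition multiples (r i : nat) : int := (r %| i)%N%:R.

Section Functional.
Variables (R : nzRingType) (f : nat -> R).

(** The linear functional taking ['X^k] to [f k] for [k < N]; it turns [diff] into multiplication by
    ['X - 1]. *)
Definition coef_pairing N (P : {poly R}) : R := \sum_(j < N) P`_j * f j.

Lemma coef_pairingB N P Q :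
  coef_pairing N (P - Q) = coef_pairing N P - coef_pairing N Q.
Proof.
by rewrite /coef_pairing -sumrB; apply: eq_bigr => j _; rewrite coefB mulrBl.
Qed.

Lemma coef_pairingXn N k : (k < N)%N -> coef_pairing N 'X^k = f k.
Proof.
move=> ltkN; rewrite /coef_pairing (bigD1 (Ordinal ltkN)) //= coefXn eqxx mul1r.
rewrite big1 ?addr0 // => j; rewrite -val_eqE /= coefXn => /negPf ->.
by rewrite mul0r.
Qed.

Lemma iter_diff_pairing N n i : (i + n < N)%N ->
  iter n (@diff R) f i = coef_pairing N ('X^i * ('X - 1) ^+ n).
Proof.
elim: n i => [|n IHn] i ltN; first by rewrite mulr1 coef_pairingXn // -[i]addn0.
rewrite iter_diffS !IHn ?addSnnS -?coef_pairingB //; last by lia.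
by rewrite -mulrBl exprSr -[X in _ - X]mulr1 -mulrBr exprS !mulrA.
Qed.

End Functional.

(* Modulo [q], the iterate of [diff] of order [q ^ n] is the shift by [q ^ n]
   minus the identity. *)
Lemma multiples_diff_dvd (q r n : nat) : prime q ->
  (forall i, (q %| iter n (@diff int) (multiples r) i)%Z) ->
  exists s, (r %| q ^ s)%N.
Proof.
move=> q_pr dvq; exists n.
pose f i : 'F_q := (multiples r i)%:~R.
have fE m i : iter m (@diff _) f i = (iter m (@diff int) (multiples r) i)%:~R.
  by elim: m i => // m IHm i; rewrite !iter_diffS !IHm rmorphB.
have qF := pchar_Fp q_pr.
have f0 i : iter n (@diff _) f i = 0.
  rewrite fE; have /dvdzP[k ->] := dvq i.
  by rewrite rmorphM /= -(pmulrn 1 q) (pcharf0 qF) mulr0.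
(* Raising the order from [n] to a power of the characteristic makes the binomial expansion collapse
   to two terms. *)
have le_n : (n <= q ^ n)%N by rewrite ltnW // ltn_expl // prime_gt1.
have := iter_diff_eq0 le_n f0 0.
rewrite (@iter_diff_pairing _ f (q ^ n).+1) // mul1r.
have qP : q \in [pchar {poly 'F_q}] by rewrite pchar_poly.
have -> : ('X - 1) ^+ (q ^ n) = 'X^(q ^ n) - 'X^0 :> {poly 'F_q}.
  have qn : [pchar {poly 'F_q}].-nat (q ^ n)%N.
    by rewrite (eq_pnat _ (pcharf_eq qP)) pnatX pnat_id.
  by rewrite exprDn_pchar // exprNn_pchar // expr1n expr0.
(* The value at 0 is [multiples r (q ^ n) - 1], which is [-1] unless [r] divides [q ^ n]. *)
rewrite coef_pairingB !coef_pairingXn // /f /multiples dvdn0 => /eqP.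
by case: (_ %| _)%N => //; rewrite sub0r oppr_eq0 oner_eq0.
Qed.

End FiniteDifferences.

(** * Powers with integer exponents *)

Section IntegerPowers.
Variable gT : groupType.
Implicit Types (g h : gT) (a b : int).

Definition expgz g a : gT :=
  match a with Posz n => g ^+ n | Negz n => g ^- n.+1 end.

Lemma commuteVX g m n : g ^- m * g ^+ n = g ^+ n * g ^- m.
Proof. by apply/commute_sym/commuteV/commuteX2/commute_refl. Qed.

Lemma expgz_natB g m n : expgz g (m%:Z - n%:Z)%R = g ^- n * g ^+ m.
Proof.
case: (leqP n m) => [le_nm|lt_mn].
  by rewrite subzn // /= expgnFr // commuteVX.
have -> : (m%:Z - n%:Z)%R = Negz (n - m).-1 by lia.
by rewrite /= prednK ?subn_gt0 // expgnFr 1?ltnW // invgF commuteVX.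
Qed.

Lemma int_natB a : exists m n : nat, a = (m%:Z - n%:Z)%R.
Proof.
by case: a => n; [exists n, 0 | exists 0, n.+1]; lia.
Qed.

(** The order of the factors is that of [[~ h, x] = h^-1 * h ^ x], so that commutators subtract
    exponents. *)
Lemma expgzB g a b : expgz g (a - b)%R = (expgz g b)^-1 * expgz g a.
Proof.
have [m [n ->]] := int_natB a; have [p [q ->]] := int_natB b.
have -> : (m%:Z - n%:Z - (p%:Z - q%:Z))%R = ((q + m)%N%:Z - (n + p)%N%:Z)%R by lia.
rewrite !expgz_natB !expgnDr !invgM invgK -!mulgA; congr (_ * _).
by rewrite !mulgA commuteVX.
Qed.

Lemma expgzJ g h a : expgz (g ^ h) a = expgz g a ^ h.
Proof. by case: a => n; rewrite /= ?conjVg conjXg. Qed.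

Lemma expgz_eq1 g a : (expgz g a == 1) = (g ^+ `|a| == 1).
Proof. by case: a => n //=; rewrite invg_eq1. Qed.

End IntegerPowers.

(** * Orders of elements killed by the difference coefficients *)

Section Orders.
Variable gT : groupType.
Implicit Types (x g : gT) (p m n : nat).

Lemma has_order_dvd x m : has_order x m -> forall n, (x ^+ n == 1) = (m %| n).
Proof.
move=> [m0 xm1 minm] n; apply/eqP/idP => [xn1|/dvdnP[k ->]]; last first.
  by rewrite mulnC expgnA xm1 expg1n.
have xmod : x ^+ (n %% m) = 1.
  by move: xn1; rewrite {1}(divn_eq n m) expgnDr mulnC expgnA xm1 expg1n mul1g.
rewrite /dvdn; case: posnP => // nm0; case: (minm (n %% m)) => //.
by rewrite nm0 ltn_mod.
Qed.

Lemma has_order_exists x n : (0 < n)%N -> x ^+ n = 1 ->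
  exists m, has_order x m.
Proof.
move=> n0 xn1; have exm : exists m, (0 < m)%N && (x ^+ m == 1).
  by exists n; rewrite n0 xn1 eqxx.
case: (ex_minnP exm) => m /andP[m0 /eqP xm1] minm; exists m.
split=> // k /andP[k0 ltkm] /eqP xk1.
by have := minm k; rewrite k0 xk1 leqNgt ltkm => /(_ isT).
Qed.

Lemma p_elementP p x : prime p ->
  p_element p x <-> exists k, x ^+ (p ^ k) = 1.
Proof.
move=> p_pr; split=> [[k [_ xk _]]|[k xk]]; first by exists k.
have [] := has_order_exists (n := (p ^ k)%N) _ xk.
  by rewrite expn_gt0 prime_gt0.
move=> m om; have /eqP := xk; rewrite (has_order_dvd om).
by case/(dvdn_pfactor _ _ p_pr) => j _ mE; exists j; rewrite -mE.
Qed.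

Lemma p_element_eq1 p q x : prime p -> prime q -> p != q ->
  p_element p x -> p_element q x -> x = 1.
Proof.
move=> p_pr q_pr pq [j oj] [k ok].
have := has_order_dvd oj (q ^ k); have [_ -> _] := ok.
rewrite eqxx => /esym jk; apply/eqP; rewrite -[x]expg1 (has_order_dvd oj).
by rewrite -(eqP (coprimeXl j (coprimeXr k _) : coprime (p ^ j) (q ^ k)))
  ?dvdn_gcd ?dvdnn // prime_coprime // dvdn_prime2.
Qed.

Lemma multiples_diff_prime (p q r n : nat) : prime p -> prime q -> (p %| r)%N ->
  (forall i, (q %| iter n (@diff int) (multiples r) i)%Z) -> p = q.
Proof.
move=> p_pr q_pr pr dvq; have [s rq] := multiples_diff_dvd q_pr dvq.
by have := dvdn_trans pr rq; rewrite Euclid_dvdX // dvdn_prime2 // => /andP[/eqP].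
Qed.

(** If all values vanished, every prime would divide them, and [pdiv r] would equal both 2 and 3. *)
Lemma multiples_diff_neq0 (r n : nat) : (1 < r)%N ->
  exists i, iter n (@diff int) (multiples r) i != 0%R.
Proof.
move=> r1; apply: contrapT => /forallNP a0.
have p_pr := pdiv_prime r1; have pr := pdiv_dvd r.
have ap q : prime q -> pdiv r = q.
  move=> q_pr; apply: (multiples_diff_prime (n := n) p_pr q_pr pr) => i.
  by have /negP := a0 i; rewrite negbK => /eqP ->; rewrite dvdz0.
by have := ap 2 isT; rewrite (ap 3).
Qed.

Section Annihilated.
Variables (g : gT) (r n : nat).
Hypotheses (r1 : (1 < r)%N)
  (ann : forall i, g ^+ `|iter n (@diff int) (multiples r) i| = 1).

Lemma annihilated_finite_order : exists2 k, has_order g k &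
  forall i, (k %| iter n (@diff int) (multiples r) i)%Z.
Proof.
have [i ai] := multiples_diff_neq0 n r1.
have [k ok] := has_order_exists (etrans (absz_gt0 _) ai) (ann i).
by exists k => // j; rewrite dvdzE /= -(has_order_dvd ok) ann.
Qed.

(** A prime dividing the order of [g] divides every coefficient, so each prime factor of [r] equals
    it. *)
Lemma annihilated_pnat : g <> 1 -> (pdiv r).-nat r.
Proof.
move=> g1; have [k ok dvk] := annihilated_finite_order.
have k1 : (1 < k)%N.
  have [k0 gk _] := ok; by case: k k0 gk {ok dvk} => [|[|k]].
have q_pr := pdiv_prime k1; have p_pr := pdiv_prime r1.
have dvq i : (pdiv k %| iter n (@diff int) (multiples r) i)%Z.
  by apply: dvdz_trans (dvk i); exact: pdiv_dvd.
rewrite (multiples_diff_prime p_pr q_pr (pdiv_dvd r) dvq).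
apply/pnatP => [|q qp qr]; first exact: ltnW.
by rewrite inE (multiples_diff_prime qp q_pr qr dvq).
Qed.

Lemma annihilated_p_element : p_element (pdiv r) g.
Proof.
have [k ok dvk] := annihilated_finite_order.
have p_pr := pdiv_prime r1.
have /p_natP[e kE] : (pdiv r).-nat k.
  apply/pnatP => [|q q_pr qk]; first by case: ok.
  rewrite inE; apply/eqP/esym.
  apply: (multiples_diff_prime p_pr q_pr (pdiv_dvd r)) => i.
  by apply: dvdz_trans (dvk i).
by exists e; rewrite -kE.
Qed.

End Annihilated.
End Orders.

(** * Closure properties of subgroups *)

Section Subgroups.
Variables (gT : groupType) (G : set gT).
Hypothesis sG : subgroup G.

Lemma subgroup1 : G 1.
Proof. by have [] := sG; rewrite in_setE. Qed.

Lemma subgroupV g : G g -> G g^-1.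
Proof. by have := group_closedV sG => /(_ g); rewrite !in_setE. Qed.

Lemma subgroupM g h : G g -> G h -> G (g * h).
Proof. by have := group_closedM sG => /(_ g h); rewrite !in_setE. Qed.

End Subgroups.

Lemma subgroupI (gT : groupType) (G : set gT) : G 1 ->
  (forall g h, G g -> G h -> G (g * h)) -> (forall g, G g -> G g^-1) ->
  subgroup G.
Proof.
move=> G1 GM GV; split; rewrite ?in_setE // => g h.
by rewrite !in_setE => Gg Gh; apply/GM/GV.
Qed.

(** * Tree automorphisms and rigid stabilizers *)

Section Tree.
Variable d : nat -> nat.
Implicit Types (u v w : vertex d) (f g h x : aut d) (G : set (aut d)).

Lemma prefix_size_inj u v w :
  prefix u w -> prefix v w -> size u = size v -> u = v.
Proof.
rewrite !prefixE => /eqP uw /eqP vw uv; apply: val_inj.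
by rewrite /= -uw -vw uv.
Qed.

Lemma is_vertex_take v k : is_vertex d (take k v).
Proof.
have /allP wv := wordP v; apply/allP => i; rewrite mem_iota size_take_min.
rewrite add0n leq_min /= => /andP[ik iv]; rewrite nth_take //.
by apply: wv; rewrite mem_iota.
Qed.

Definition ancestor v k : vertex d := Vertex (is_vertex_take v k).

Lemma ancestor_prefix v k : prefix (ancestor v k) v.
Proof. exact: prefix_take. Qed.

Lemma ancestor_size v k : (k <= size v)%N -> size (ancestor v k) = k.
Proof. exact: size_takel. Qed.

Lemma child_parent v : (0 < size v)%N -> child (ancestor v (size v).-1) v.
Proof.
by move=> v0; rewrite /child ancestor_prefix ancestor_size ?leq_pred // prednK /=.
Qed.

Lemma child_size u v : child u v -> size v = (size u).+1.
Proof. by case/andP => _ /eqP. Qed.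

(** Incidence does not orient edges. Let [u] be the parent of [v] and [t] that of [u]: if [f v] were
    the parent of [f u], it would equal [f t], against injectivity. *)
Lemma aut_size f v : size (f v) = size v.
Proof.
have [n] := ubnP (size v); elim: n v => // n IHn v lt_vn.
have [v0|v0] := posnP (size v).
  have -> : v = tree_root d by apply/val_inj/size0nil.
  by rewrite aut_root.
have cuv := child_parent v0; set u := ancestor _ _ in cuv.
have sv := child_size cuv.
have fu : size (f u) = size u by apply: IHn; rewrite -ltnS -sv.
have : incident (f u) (f v) by rewrite aut_incident /incident cuv.
case/orP => [/child_size -> |cfvu]; first by rewrite fu.
have su := child_size cfvu; rewrite fu in su.
have u0 : (0 < size u)%N by rewrite su.
have ctu := child_parent u0; set t := ancestor _ _ in ctu.
have st := child_size ctu.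
have ft : size (f t) = size t by apply: IHn; lia.
have : incident (f t) (f u) by rewrite aut_incident /incident ctu.
case/orP => [cftu|/child_size]; last by lia.
have [pt _] := andP cftu; have [pv _] := andP cfvu.
have /(bij_inj (aut_bij f)) tv : f t = f v by apply: prefix_size_inj pt pv _; lia.
by move: sv; rewrite st tv; lia.
Qed.

Lemma childE u v : child u v = incident u v && (size u < size v)%N.
Proof.
apply/idP/andP => [cuv|[/orP[//|/child_size]]]; last by lia.
by rewrite /incident cuv (child_size cuv).
Qed.

Lemma aut_child f u v : child (f u) (f v) = child u v.
Proof. by rewrite !childE aut_incident !aut_size. Qed.

Lemma aut_prefixW f u v : prefix u v -> prefix (f u) (f v).
Proof.
have [n] := ubnP (size v); elim: n v => // n IHn v lt_vn uv.
have [vu|ltuv] := leqP (size v) (size u).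
  have -> // : u = v; last exact: prefix_refl.
  apply: (prefix_size_inj uv (prefix_refl v)); apply/eqP.
  by rewrite eqn_leq vu (size_prefix uv).
have cwv := child_parent (leq_ltn_trans (leq0n _) ltuv).
set w := ancestor _ _ in cwv.
have sv := child_size cwv.
have uw : prefix u w.
  rewrite prefixE /= take_takel; last by lia.
  by rewrite -prefixE.
have /andP[fwv _] : child (f w) (f v) by rewrite aut_child.
by apply: prefix_trans fwv; apply: IHn => //; lia.
Qed.

Lemma aut_prefix f u v : prefix (f u) (f v) = prefix u v.
Proof.
apply/idP/idP => [|/aut_prefixW //].
by move/(aut_prefixW f^-1); rewrite !autVK.
Qed.

Lemma autV_fix g u : g u = u -> g^-1 u = u.
Proof. by move=> gu; rewrite -{1}gu autVK. Qed.

Lemma autX_fix g n u : g u = u -> (g ^+ n) u = u.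
Proof. by move=> gu; elim: n => // n IHn; rewrite expgS autME IHn. Qed.

Lemma expgz_fix g a u : g u = u -> expgz g a u = u.
Proof. by case: a => n gu /=; [|apply: autV_fix]; apply: autX_fix. Qed.

Lemma autX_eq g h v : g v = v -> (forall u, prefix v u -> h u = g u) ->
  forall n u, prefix v u -> (h ^+ n) u = (g ^+ n) u.
Proof.
move=> gv hg; elim=> // n IHn u vu.
by rewrite !expgSr !autME hg // IHn // -{1}gv aut_prefix.
Qed.

Lemma rst_fix G g v u : rst G v g -> ~~ prefix v u -> g u = u.
Proof. by case=> _ gfix vu; apply: gfix; apply/negP. Qed.

Lemma rst_sub G g v : rst G v g -> G g.
Proof. by case. Qed.

(** Only [v] is in doubt: if [g v] left the subtree of [v], it would be fixed by [g], and
    injectivity would give [g v = v]. *)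
Lemma rst_fix_level G g v u : rst G v g -> size u = size v -> g u = u.
Proof.
move=> gv uv; have [vu|] := boolP (prefix v u); last exact: rst_fix gv.
have <- : v = u by apply: prefix_size_inj vu (prefix_refl u) _.
apply: contrapT => gvv; have [vgv|] := boolP (prefix v (g v)).
  by apply/gvv/esym/(prefix_size_inj vgv (prefix_refl _)); rewrite aut_size.
by move/(rst_fix gv) => /(bij_inj (aut_bij g)).
Qed.

Lemma rst_mono G v w : prefix v w -> rst G w `<=` rst G v.
Proof.
move=> vw g [Gg gfix]; split=> // u nvu; apply: gfix => wu; apply: nvu.
exact: prefix_trans vw wu.
Qed.

Lemma rst_subgroup G v : subgroup G -> subgroup (rst G v).
Proof.
move=> sG; apply: subgroupI => [|g h gv hv|g gv].
- by split=> //; exact: subgroup1.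
- split=> [|u /negP vu]; first exact: subgroupM (rst_sub gv) (rst_sub hv).
  by rewrite autME (rst_fix hv vu) (rst_fix gv vu).
- split=> [|u /negP vu]; first exact: subgroupV (rst_sub gv).
  by apply: autV_fix; exact: rst_fix gv vu.
Qed.

Lemma rst_conj G f g v w : subgroup G -> G f -> rst G v g -> f w = v ->
  rst G w (g ^ f).
Proof.
move=> sG Gf /[swap] <- gv; split=> [|u nwu].
  have Gg := rst_sub gv.
  by apply: (subgroupM sG); [apply: subgroupV|apply: subgroupM].
rewrite !autME (rst_fix gv) ?autVK // aut_prefix; exact/negP.
Qed.

(** * Engel commutators computed locally along an orbit *)

Section EngelCommutator.
Variables (x g : aut d) (v : vertex d) (a : nat -> int) (N : nat).
Hypothesis gv : g v = v.
Hypothesis base : forall i u, (i <= N)%N -> prefix ((x ^+ i) v) u ->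
  g u = expgz (g ^ x ^- i) (a i) u.

(** On the subtree of [(x ^+ i) v], [h ^ x] reflects the action of [h] on that of [(x ^+ i.+1) v],
    so [h^-1 * h ^ x] takes differences of exponents. Each commutator uses one more translate,
    whence the bound [N]. *)
Lemma engel_comm_subtree n i u : (i + n <= N)%N -> prefix ((x ^+ i) v) u ->
  engel_comm n g x u = expgz (g ^ x ^- i) (iter n (@diff int) a i) u.
Proof.
elim: n i u => [|n IHn] i u le_N vu; first by apply: base; rewrite // -[i]addn0.
rewrite iter_diffS expgzB; set b := iter n _ a.
set h := engel_comm n g x; rewrite [engel_comm _ _ _]/= -/(engel_comm n g x) -/h.
have fixK c : expgz (g ^ x ^- i) c ((x ^+ i) v) = (x ^+ i) v.
  by apply: expgz_fix; rewrite conjgE invgK !autME autVK gv.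
have hx : (h ^ x) u = expgz (g ^ x ^- i) (b i.+1) u.
  rewrite conjgE !autME (IHn i.+1) ?addSnnS //; last first.
    by rewrite expgS autME aut_prefix.
  have -> : x ^- i = x ^- i.+1 * x by rewrite expgS invgM mulgVK.
  by rewrite conjgM (expgzJ (g ^ x ^- i.+1)) conjgE !autME.
rewrite commgEl autME hx [RHS]autME; set w := expgz (g ^ x ^- i) (b i.+1) u.
have vw : prefix ((x ^+ i) v) w by rewrite -(fixK (b i.+1)) aut_prefix.
set K := expgz (g ^ x ^- i) (b i).
have vKw : prefix ((x ^+ i) v) (K^-1 w).
  by rewrite -(autV_fix (fixK (b i))) aut_prefix.
(* [h] and [K] agree only on this subtree, so their inverses are compared at [w] through this
   equation. *)
have hK : h (K^-1 w) = w by rewrite (IHn i) ?autKV //; lia.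
by rewrite -{1}hK autVK.
Qed.

(** Outside the subtree of [(x ^+ i) v] the conjugate [g ^ x ^- i] is trivial, so the local formula
    determines its power everywhere. *)
Lemma engel_comm_annihilates G n i : rst G v g -> engel_comm n g x = 1 ->
  (i + n <= N)%N -> g ^+ `|iter n (@diff int) a i| = 1.
Proof.
move=> rg en le_N; apply/eqP; rewrite -expgz_eq1 -(conjg_eq1 _ (x ^- i)) -expgzJ.
apply/eqP/autP => u; have [vu|vu] := boolP (prefix ((x ^+ i) v) u).
  by rewrite -engel_comm_subtree // en.
apply: expgz_fix; rewrite conjgE invgK !autME (rst_fix rg) ?autKV //.
by rewrite -(aut_prefix (x ^+ i)) autKV.
Qed.

End EngelCommutator.

(** * Orbit lengths of vertices *)

Definition period x v (r : nat) := forall i, ((x ^+ i) v == v) = (r %| i).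

Lemma period_exists x v n : (0 < n)%N -> (x ^+ n) v = v ->
  exists2 r, (0 < r)%N & period x v r.
Proof.
move=> n0 xn; have exr : exists r, (0 < r)%N && ((x ^+ r) v == v).
  by exists n; rewrite n0 xn eqxx.
case: (ex_minnP exr) => r /andP[r0 /eqP xr] minr; exists r => // i.
have xkr k : (x ^+ (k * r)) v = v by rewrite mulnC expgnA autX_fix.
apply/eqP/idP => [xi|/dvdnP[k ->]//].
have xmod : (x ^+ (i %% r)) v = v.
  by move: xi; rewrite {1}(divn_eq i r) addnC expgnDr autME xkr.
rewrite /dvdn; case: posnP => // m0; have := minr (i %% r).
by rewrite m0 xmod eqxx leqNgt ltn_mod r0 => /(_ isT).
Qed.

Lemma period_self x v r : period x v r -> (x ^+ r) v = v.
Proof. by move=> per; apply/eqP; rewrite per. Qed.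

Lemma prefix_fix f v w : prefix v w -> f w = w -> f v = v.
Proof.
move=> vw fw; apply: (@prefix_size_inj _ _ w); rewrite ?aut_size //.
by rewrite -fw aut_prefix.
Qed.

Lemma period_prefix x v w r s : prefix v w -> period x v r -> period x w s ->
  (r %| s).
Proof. by move=> vw pv /period_self /(prefix_fix vw) /eqP; rewrite pv. Qed.

(** Take [w] of maximal orbit length below [v]: orbit lengths below [w] are multiples of [r], hence
    equal to [r]. *)
Lemma locally_max_period x m v : (0 < m)%N -> x ^+ m = 1 ->
  exists w r, [/\ prefix v w, (0 < r)%N, period x w r
    & forall u, prefix w u -> (x ^+ r) u = u].
Proof.
move=> m0 xm; pose P r := `[< exists2 w : vertex d, prefix v w & period x w r >].
have perm u : exists2 r, (0 < r)%N & period x u r.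
  by apply: (period_exists m0); rewrite xm.
have Pm r : P r -> (r <= m)%N.
  by move=> /asboolP[w _ pw]; apply: dvdn_leq m0 _; rewrite -pw xm.
have exP : exists r, P r.
  have [r _ pr] := perm v; exists r.
  by apply/asboolP; exists v; rewrite ?prefix_refl.
case: (ex_maxnP exP Pm) => r /asboolP[w vw pw] maxr; exists w, r.
have [r' r'0 pw'] := perm w.
have r0 : (0 < r)%N by apply: dvdn_gt0 r'0 _; rewrite -pw period_self.
split=> // u wu; have [s s0 pu] := perm u.
have rs := period_prefix wu pw pu.
have sr : (s <= r)%N.
  by apply/maxr/asboolP; exists u => //; exact: prefix_trans wu.
have -> : r = s by apply/eqP; rewrite eqn_leq sr dvdn_leq.
exact: period_self.
Qed.

(** The supports are disjoint: [x ^+ r] is trivial on the subtree of [v], and [g] outside it. *)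
Lemma rst_commute G g x r v : rst G v g -> (x ^+ r) v = v ->
  (forall u, prefix v u -> (x ^+ r) u = u) -> commute g (x ^+ r).
Proof.
move=> rg xv xT; apply: autP => u; rewrite !autME.
have gT : prefix v u -> prefix v (g u).
  by move=> vu; rewrite -(rst_fix_level rg (erefl _)) aut_prefix.
have [vu|vu] := boolP (prefix v u); first by rewrite xT // xT // gT.
by rewrite (rst_fix rg vu) (rst_fix rg) // -xv aut_prefix.
Qed.

(** On the subtree of [(x ^+ j) v], [g] equals its conjugate by [x ^- j] if [r] divides [j] and is
    trivial otherwise: the exponents are [multiples r]. *)
Lemma engel_multiples_annihilate G g x r v n : rst G v g -> period x v r ->
  (forall u, prefix v u -> (x ^+ r) u = u) -> engel_comm n g x = 1 ->
  forall i, g ^+ `|iter n (@diff int) (multiples r) i| = 1.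
Proof.
move=> rg per xT en i; have gv := rst_fix_level rg (erefl _).
apply: (@engel_comm_annihilates x g v _ (i + n) gv _ G n) => // j u _ vu.
rewrite /multiples; case: (boolP (r %| j)) => [/dvdnP[k jE]|rj].
  have cg := rst_commute rg (period_self per) xT.
  have -> // : g ^ x ^- j = g.
  by apply/conjg_fixP/commgP; rewrite jE mulnC expgnA; apply/commuteV/commuteX.
apply: (rst_fix rg); move: rj; rewrite -per; apply: contra => vu'.
by rewrite (prefix_size_inj vu vu') ?aut_size.
Qed.

End Tree.

(** * Rigid stabilizers and Engel elements of weakly branch groups *)

Section WeaklyBranch.
Variables (d : nat -> nat) (G : set (aut d)).
Implicit Types (u v w : vertex d) (g h x y : aut d).

Lemma aut_neq1 g : g <> 1 -> exists u, g u <> u.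
Proof.
move=> g1; apply: contrapT => /forallNP gid; apply/g1/autP => u.
exact: (contrapT (gid u)).
Qed.

Lemma rst_neq1_moves v g : rst G v g -> g <> 1 ->
  exists2 u : vertex d, prefix v u & g u <> u.
Proof.
move=> gv /aut_neq1[u gu]; exists u => //.
by apply: contrapT => /negP /(rst_fix gv).
Qed.

Lemma rst_prefix v g u : rst G v g -> prefix v (g u) = prefix v u.
Proof. by move=> gv; rewrite -{1}(rst_fix_level gv (erefl _)) aut_prefix. Qed.

Section Level.
Variable n : nat.

(* In a product of elements of rigid stabilizers of level [n] only finitely
   many components are nontrivial, whence a common bound on their orders. *)
Definition rst_product : set (aut d) := [set h |
  (forall v, size v = n ->
     exists2 g, rst G v g & forall u, prefix v u -> h u = g u) /\
  exists S : seq (vertex d), forall u, h u <> u ->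
    exists2 v : vertex d, v \in S & size v = n /\ prefix v u].

Lemma rst_product_subgroup : subgroup G -> subgroup rst_product.
Proof.
move=> sG; apply: subgroupI => [|g h [gP [S gS]] [hP [T hT]]|h [hP [S hS]]].
- split; last by exists [::].
  by move=> v _; exists 1 => //; exact: (subgroup1 (rst_subgroup v sG)).
- split=> [v vn|].
    have [a av ga] := gP v vn; have [b bv hb] := hP v vn.
    exists (a * b) => [|u vu]; first exact: (subgroupM (rst_subgroup v sG)).
    by rewrite !autME hb // ga // rst_prefix.
  exists (S ++ T) => u; rewrite autME.
  have [->|/eqP hu _] := eqVneq (h u) u.
    by move=> /gS[v vS vu]; exists v; rewrite // mem_cat vS.
  by have [v vT vu] := hT _ hu; exists v; rewrite // mem_cat vT orbT.
- split=> [v vn|].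
    have [a av ha] := hP v vn.
    have aVv : rst G v a^-1 by exact: (subgroupV (rst_subgroup v sG)).
    exists a^-1 => // u vu; rewrite -{1}(autKV a u) -ha ?autVK //.
    by rewrite (rst_prefix _ aVv).
  by exists S => u hu; apply: hS => hu'; apply: hu; exact: autV_fix.
Qed.

Lemma rst_sub_product v : subgroup G -> size v = n -> rst G v `<=` rst_product.
Proof.
move=> sG vn g gv; split=> [w wn|].
  have [->|vw] := eqVneq w v; first by exists g.
  exists 1 => [|u wu]; first exact: (subgroup1 (rst_subgroup _ sG)).
  apply: (rst_fix gv); apply: contra vw => vu.
  by apply/eqP/(prefix_size_inj wu vu); rewrite wn.
exists [:: v] => u gu; exists v; rewrite ?inE //; split=> //.
by apply: contrapT => /negP /(rst_fix gv).
Qed.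

(** On each of the finitely many subtrees listed in [S], some power of [p] kills [h]; the product of
    these powers kills it everywhere. *)
Lemma rst_product_p_set p : prime p ->
  (forall v, size v = n -> p_set p (rst G v)) -> p_set p rst_product.
Proof.
move=> p_pr pG h [hP [S hS]]; apply/(p_elementP _ p_pr).
suff [k hk] : exists k, forall v, v \in S -> size v = n ->
    forall u, prefix v u -> (h ^+ (p ^ k)) u = u.
  exists k; apply: autP => u; have [/(autX_fix (p ^ k))//|/eqP hu] := eqVneq (h u) u.
  by have [v vS [vn vu]] := hS _ hu; apply: hk vu.
elim: {hS} S => [|v S [k hk]]; first by exists 0.
have [j hj] : exists j, size v = n ->
    forall u, prefix v u -> (h ^+ (p ^ j)) u = u.
  have [vn|vn] := eqVneq (size v) n; last by exists 0 => /eqP; rewrite (negPf vn).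
  have [a av ha] := hP v vn.
  have /(p_elementP _ p_pr)[j aj] := pG v vn a av.
  exists j => _ u vu; rewrite (autX_eq _ ha) ?aj //.
  exact: rst_fix_level av (erefl _).
exists (k + j) => w; rewrite inE expnD => /predU1P[->|wS] wn u wu.
  by rewrite mulnC expgnA autX_fix // hj.
by rewrite expgnA autX_fix // (hk w).
Qed.

End Level.

Hypothesis hG : weakly_branch G.

Lemma weakly_branch_subgroup : subgroup G.
Proof. by case: hG. Qed.
Let sG := weakly_branch_subgroup.

Lemma rst_transport v w g : size v = size w -> rst G v g ->
  exists2 f, G f & rst G w (g ^ f).
Proof.
move=> vw gv; have [_ trG _] := hG.
have [f Gf fw] := trG (size v) w v (esym vw) (erefl _).
by exists f => //; exact: rst_conj fw.
Qed.

(** Transitivity makes the rigid stabilizers of one level conjugate, so if one were trivial,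
    [rst_level] would be too. *)
Lemma rst_nontrivial v : exists2 g, rst G v g & g <> 1.
Proof.
apply: contrapT => rst1; have [_ _ /(_ (size v))] := hG; apply.
have rst1w w g : size w = size v -> rst G w g -> g = 1.
  move=> wv gw; have [f _ gf] := rst_transport wv gw.
  apply/eqP; rewrite -(conjg_eq1 g f); apply/eqP; apply: contrapT => gf1.
  by apply: rst1; exists (g ^ f).
apply/seteqP; split=> [|_ ->].
  apply: smallest_sub => [|g [w wv gw]]; last exact: rst1w gw.
  by apply: subgroupI => // [g h -> ->|g ->]; rewrite ?mulg1 ?invg1.
by move=> M [sM _]; exact: subgroup1.
Qed.

Lemma rst_level_p_set p v : prime p -> p_set p (rst G v) ->
  p_set p (rst_level G (size v)).
Proof.
move=> p_pr pv; apply: (@subset_trans _ (rst_product (size v))).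
  apply: smallest_sub; first exact: rst_product_subgroup.
  by move=> g [w wv]; exact: rst_sub_product.
apply: rst_product_p_set => // w wv g gw.
have [f _ /pv /(p_elementP _ p_pr)[k gfk]] := rst_transport wv gw.
apply/(p_elementP _ p_pr); exists k; apply/eqP.
by rewrite -(conjg_eq1 _ f) conjXg gfk.
Qed.

(** For [v] nearer the root, [rst G w] lies in the rigid stabilizer of an ancestor of [w], which is
    conjugate into [rst G v]; a nontrivial element would be both a [p]- and a [q]-element. *)
Lemma rst_prime_unique p q v w : prime p -> prime q ->
  p_set p (rst G v) -> p_set q (rst G w) -> p = q.
Proof.
wlog vw : p q v w / (size v <= size w)%N => [IH|] p_pr q_pr pv qw.
  have [vw|/ltnW wv] := leqP (size v) (size w); first exact: (IH p q v w).
  by apply/esym; exact: (IH q p w v).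
apply/eqP; apply: contrapT => /negP pq.
have [g gw g1] := rst_nontrivial w.
have [f _ gf] := rst_transport (ancestor_size vw)
  (rst_mono (ancestor_prefix w _) gw).
have gfp := pv _ gf; apply: g1; apply/eqP; rewrite -(conjg_eq1 g f); apply/eqP.
apply: (p_element_eq1 p_pr q_pr pq gfp).
have /(p_elementP _ q_pr)[k gk] := qw _ gw.
by apply/(p_elementP _ q_pr); exists k; rewrite -conjXg gk conj1g.
Qed.

(* If [u] has an orbit of maximal length [s] under [g] and [h] in the rigid
   stabilizer of [u] moves a vertex [w], then [(g * h) ^+ s] acts on the subtree
   of [u] as [h], so the orbit of [w] under [g * h] is longer. *)
Lemma rst_exponent_unbounded v c : (0 < c)%N ->
  exists2 g, rst G v g & g ^+ c <> 1.
Proof.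
move=> c0; apply: contrapT => expc.
have gc g : rst G v g -> g ^+ c = 1.
  by move=> gv; apply: contrapT => gc1; apply: expc; exists g.
pose P s := `[< exists g u, [/\ rst G v g, prefix v u & period g u s] >].
have Pc s : P s -> (s <= c)%N.
  by move=> /asboolP[g [u [gv _ pu]]]; apply: dvdn_leq c0 _; rewrite -pu gc.
have exP : exists s, P s.
  exists 1%N; apply/asboolP; exists 1, v; split; rewrite ?prefix_refl //.
    exact: (subgroup1 (rst_subgroup _ sG)).
  by move=> i; rewrite expg1n eqxx dvd1n.
have perv g u : rst G v g -> exists2 s, (0 < s)%N & period g u s.
  by move=> gv; apply: (period_exists c0); rewrite gc.
case: (ex_maxnP exP Pc) => s /asboolP[g [u [gv vu pu]]] maxs.
have s0 : (0 < s)%N by apply: dvdn_gt0 c0 _; rewrite -pu gc.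
have gT w : prefix u w -> (g ^+ s) w = w.
  move=> uw; have [t t0 pw] := perv g w gv.
  have tle : (t <= s)%N.
    by apply/maxs/asboolP; exists g, w; split=> //; exact: prefix_trans uw.
  have -> : s = t; last exact: period_self.
  by apply/eqP; rewrite eqn_leq tle dvdn_leq // (period_prefix uw pu pw).
have [h hu h1] := rst_nontrivial u; have [w uw hw] := rst_neq1_moves hu h1.
have hfix := rst_fix_level hu (erefl _).
have ghv : rst G v (g * h).
  exact: (subgroupM (rst_subgroup v sG) gv (rst_mono vu hu)).
(* [h] acts only at the first step: for [0 < j < s] the vertex [(g ^+ j) (h z)] is outside the
   subtree of [u]. *)
have ghi i (z : vertex d) : (0 < i <= s)%N -> prefix u z ->
    ((g * h) ^+ i) z = (g ^+ i) (h z).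
  case: i => // i; elim: i => [|i IHi] lti uz; first by rewrite !expg1.
  have [_ lti1] := andP lti; rewrite expgS autME IHi ?(ltnW lti1) //.
  rewrite autME [in RHS]expgS [RHS]autME; congr (g _).
  apply: (rst_fix hu); rewrite -(rst_prefix z hu) in uz.
  apply/negP => uz'; suff : (s %| i.+1) by rewrite gtnNdvd.
  rewrite -pu; apply/eqP/esym.
  by apply: (prefix_size_inj uz' (w := (g ^+ i.+1) (h z)));
    rewrite ?aut_prefix ?aut_size.
have [t t0 pw] := perv (g * h) w ghv.
have ts : (t <= s)%N.
  by apply/maxs/asboolP; exists (g * h), w; split=> //; exact: prefix_trans uw.
(* A power fixing [w] also fixes [u], so [s] divides [t] and [t = s]; but [(g * h) ^+ s] takes [w]
   to [h w]. *)
have := prefix_fix uw (period_self pw); rewrite ghi ?t0 ?prefix_refl // hfix.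
move=> /eqP; rewrite pu => st.
have tE : t = s by apply/eqP; rewrite eqn_leq ts dvdn_leq.
have := period_self pw; rewrite tE ghi ?s0 ?leqnn // gT //.
by rewrite -(rst_prefix w hu) in uw *.
Qed.

Lemma moved_locally_max x m v : (0 < m)%N -> x ^+ m = 1 -> x v <> v ->
  exists w r, [/\ prefix v w, (1 < r)%N, period x w r
    & forall u, prefix w u -> (x ^+ r) u = u].
Proof.
move=> m0 xm xv; have [w [r [vw r0 pw xT]]] := locally_max_period v m0 xm.
exists w, r; split=> //; rewrite ltn_neqAle r0 andbT; apply/eqP => r1.
by apply/xv/(prefix_fix vw); have := period_self pw; rewrite -r1.
Qed.

(** The exponent [n] varies with [g], but the prime [pdiv r] does not; one nontrivial [g] settles
    the claim on [r]. *)
Lemma engel_rst_p_set x w r : left_engel G x -> (1 < r)%N -> period x w r ->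
  (forall u, prefix w u -> (x ^+ r) u = u) ->
  (pdiv r).-nat r /\ p_set (pdiv r) (rst G w).
Proof.
move=> [_ Lx] r1 pw xT.
have ann g : rst G w g -> exists n,
    forall i, g ^+ `|iter n (@diff int) (multiples r) i| = 1.
  move=> gw; have [n en] := Lx g (rst_sub gw).
  by exists n; exact: engel_multiples_annihilate gw pw xT en.
split=> [|g gw]; last by have [n /(annihilated_p_element r1)] := ann g gw.
have [g gw g1] := rst_nontrivial w.
by have [n gn] := ann g gw; exact: annihilated_pnat gn g1.
Qed.

Lemma finite_left_engel_p_set x : (left_engel G `&` @finite_order _) x -> x <> 1 ->
  exists p, [/\ prime p, p_set p (left_engel G `&` @finite_order _)
     & exists2 n, (1 <= n)%N & p_set p (rst_level G n)].
Proof.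
move=> [Lx [m [m0 xm _]]] /aut_neq1[v xv].
have [w [r [_ r1 pw xT]]] := moved_locally_max m0 xm xv.
have p_pr := pdiv_prime r1; have [_ pG] := engel_rst_p_set Lx r1 pw xT.
exists (pdiv r); split=> //; last first.
  exists (size w); last exact: rst_level_p_set.
  (* [w] is not the root, whose orbit has length 1. *)
  rewrite lt0n; apply/negP => /eqP /size0nil w0.
  have : (r %| 1) by rewrite -pw (_ : w = tree_root d) ?aut_root //; exact: val_inj.
  by rewrite dvdn1 => /eqP rE; rewrite rE in r1.
(* The exponent is the [pdiv r]-part of [k]: below any vertex moved by [y] lies one whose orbit
   length is a power of [pdiv r] dividing [k]. *)
move=> y [Ly [k [k0 yk _]]]; apply/(p_elementP _ p_pr); exists (logn (pdiv r) k).
apply: autP => u; have [yu|/eqP yu] := eqVneq (y u) u; first exact: autX_fix.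
have [z [s [uz s1 pz yT]]] := moved_locally_max k0 yk yu.
have [s_nat qG] := engel_rst_p_set Ly s1 pz yT.
rewrite -(rst_prime_unique p_pr (pdiv_prime s1) pG qG) in s_nat.
apply: (prefix_fix uz); apply/eqP; rewrite pz -p_part -(part_pnat_id s_nat).
by apply: partn_dvd; rewrite // -pz yk.
Qed.

Lemma bounded_left_engel_trivial : bounded_left_engel G = [set 1].
Proof.
apply/seteqP; split=> [x [Gx [n en]]|_ ->]; last first.
  by split; [exact: subgroup1|exists 1%N => g _; exact: commg1].
(* The factorial is a multiple of each positive [i <= n], so a vertex moved by this power has an
   orbit longer than [n]; otherwise [x] has finite order. *)
apply: contrapT => /= x1; have [xn|xn] := pselect (x ^+ n`! = 1).
  have [v xv] := aut_neq1 x1.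
  have [w [r [_ r1 pw xT]]] := moved_locally_max (fact_gt0 n) xn xv.
  (* As [n] is uniform, this nonzero coefficient would be an exponent for all of [rst G w]. *)
  have [i ai] := multiples_diff_neq0 n r1.
  have [g gw] := rst_exponent_unbounded w (etrans (absz_gt0 _) ai).
  by case; exact: (engel_multiples_annihilate gw pw xT (en g (rst_sub gw)) i).
have [v xv] := aut_neq1 xn.
have xi i : (0 < i <= n)%N -> (x ^+ i) v <> v.
  move=> /dvdn_fact /dvdnP[k nE] xi; apply: xv.
  by rewrite nE mulnC expgnA autX_fix.
have [g gv g1] := rst_nontrivial v; apply: g1.
(* Indicator of 0: [g] is trivial on the subtrees of [(x ^+ i) v] for [0 < i <= n]. The coefficient
   at 0 becomes [(-1) ^+ n], forcing [g = 1]. *)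
pose a (i : nat) : int := ((i == 0)%N%:R)%R.
have base i u : (i <= n)%N -> prefix ((x ^+ i) v) u ->
    g u = expgz (g ^ x ^- i) (a i) u.
  case: i => [|i] le_in iu; first by rewrite invg1 conjg1.
  apply: (rst_fix gv); apply/negP => vu; apply: (xi i.+1) => //.
  by apply: (prefix_size_inj iu vu); rewrite aut_size.
have := engel_comm_annihilates (rst_fix_level gv (erefl _)) base gv
  (en g (rst_sub gv)) (leqnn (0 + n)).
rewrite iter_diff_concentrated; last by case.
by rewrite GRing.mulr1 abszX exp1n.
Qed.

End WeaklyBranch.

Theorem theoremA (d : nat -> nat) (hd : forall n, (1 < d n)%N)
    (G : set (aut d)) (hG : weakly_branch G) :
  bounded_left_engel G = [set 1] /\
  ((exists2 x, (left_engel G `&` @finite_order _) x & x <> 1) ->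
   exists p, [/\ prime p, p_set p (left_engel G `&` @finite_order _)
     & exists2 n, (1 <= n)%N & p_set p (rst_level G n)]).
Proof.
split; first exact: bounded_left_engel_trivial.
by case=> x; exact: finite_left_engel_p_set.
Qed.
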